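(* For every integer $d \ge 1$ there exists a constant $c > 0$ (depending only on $d$) such that for every positive integer $n$ there exists a set of $n$ distinct points in $[0,1]^d$ with the property that any two distinct points $x = (x_1, \dotsc, x_d)$ and $y = (y_1, \dotsc, y_d)$ of the set satisfy \[ |(x_1 - y_1)(x_2 - y_2) \dotsm (x_d - y_d)| \ge \frac{c}{n}. \] In particular (case $d = 3$), there is a constant $c>0$ such that for every positive integer $n$ it is possible to find $n$ points in $[0,1]^3$ such that $|(x_1-y_1)(x_2-y_2)(x_3-y_3)| \ge c/n$ for any two distinct points $(x_1,x_2,x_3)$ and $(y_1,y_2,y_3)$ among them. *)

(* Defs.v *)
From mathcomp Require Import all_boot all_order all_algebra finmap.
From mathcomp Require Import reals.

Set Implicit Arguments.
Unset Strict Implicit.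
Unset Printing Implicit Defensive.

Import Order.TTheory GRing.Theory Num.Theory.

Local Open Scope ring_scope.

Definition in_unit_cube (R : realType) (d : nat) (x : 'rV[R]_d) : Prop :=
  forall i : 'I_d, 0 <= x ord0 i <= 1.

(* Main.v *)
Require Import Defs.
From mathcomp Require Import all_boot all_order all_algebra finmap.
From mathcomp Require Import polyrcf ring lra zify.
From mathcomp Require Import reals.

Set Implicit Arguments.
Unset Strict Implicit.
Unset Printing Implicit Defensive.

Import Order.TTheory GRing.Theory Num.Theory.

Local Open Scope ring_scope.

(** The points come from the ring of integers of a totally real number field
    of degree [d].  Let [f] be a monic irreducible integer polynomial of degree
    [d] with [d] distinct real roots [a_1, ..., a_d].  For a nonzero integer
    polynomial [p] of degree less than [d], the product of the [p(a_i)] is the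
    norm of an algebraic integer, hence an integer
    ([prod_horner_roots_int]), and it is nonzero since [f] is coprime to [p];
    so its absolute value is at least 1 ([prod_horner_roots_ge1]).

    A suitable [f] is [X (X - 8) ... (X - 8 (d - 1)) + 2].  It is irreducible
    by the criterion of Eisenstein at 2, and adding 2 is too small a
    perturbation to destroy the sign changes of the product around
    [0, 8, ..., 8 (d - 1)], so all the roots are real ([eisenstein_poly_roots]).

    Given [n], choose [m] with [n <= m ^ d <= 2 ^ d n].  The polynomials of
    degree less than [d] with coefficients in [{0, ..., m - 1}] number
    [m ^ d >= n], and their values at the [a_i] are at most [B m] in absolute
    value, where [B] depends only on [f].  Dividing the vectors
    [(p(a_1), ..., p(a_d))] by [2 B m] and translating them puts them into the
    unit cube, and divides the products of coordinate differences by
    [(2 B m) ^ d <= (4 B) ^ d n] ([spread_points]).  Thus [c = (4 B) ^- d]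
    works. *)

Local Notation toR R := (map_poly (intr : int -> R)).

(** With [M] the integer matrix of multiplication by [p] modulo [f] in the
    basis of monomials, the columns of the Vandermonde matrix of the roots are
    eigenvectors of [M] with eigenvalues [p(a_i)]; so the product is [\det M].
    The roots being distinct, the Vandermonde determinant can be cancelled. *)
Lemma prod_horner_roots_int (R : numFieldType) (d : nat) (f p : {poly int})
    (a : 'rV[R]_d) :
  f \is monic -> size f = d.+1 -> injective (a 0) ->
  (forall i, root (toR R f) (a 0 i)) ->
  exists z : int, \prod_(i < d) (toR R p).[a 0 i] = z%:~R.
Proof.
move=> f_monic size_f a_inj root_a.
pose r (j : 'I_d) := Pdiv.CommonRing.rmodp ('X^j * p) f.
pose M := \matrix_(j < d, k < d) (r j)`_k.
pose V := Vandermonde d a.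
pose D := diag_mx (\row_i (toR R p).[a 0 i]).
exists (\det M).
have size_r j : (size (r j) <= d)%N.
  by rewrite -ltnS -size_f Pdiv.CommonRing.ltn_rmodpN0 ?monic_neq0.
have eigenMV : map_mx intr M *m V = V *m D.
  apply/matrixP=> j i; rewrite mul_mx_diag !mxE.
  have := congr1 (fun q => (toR R q).[a 0 i])
            (Pdiv.RingMonic.rdivp_eq f_monic ('X^j * p)).
  rewrite /= -/(r j) rmorphD !rmorphM /= map_polyXn !hornerE.
  rewrite (rootP (root_a i)) mulr0 add0r => ->.
  rewrite (@horner_coef_wide _ d); last first.
    by rewrite (leq_trans (size_poly _ _)).
  by apply: eq_bigr => k _; rewrite !mxE coef_map.
have detV_neq0 : \det V != 0.
  rewrite det_Vandermonde; apply/prodf_neq0 => i _; apply/prodf_neq0 => j ij.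
  by rewrite subr_eq0 (inj_eq a_inj) neq_ltn ij orbT.
have /(congr1 determinant) := eigenMV.
rewrite !det_mulmx det_map_mx det_diag mulrC => /(mulfI detV_neq0) ->.
by apply: eq_bigr => i _; rewrite mxE.
Qed.

(** A nonzero polynomial of smaller degree is coprime to the irreducible [f]
    over the rationals, so it vanishes at no root of [f]; and a nonzero integer
    has absolute value at least 1. *)
Lemma prod_horner_roots_ge1 (R : numFieldType) (d : nat) (f p : {poly int})
    (a : 'rV[R]_d) :
  f \is monic -> irreducible_poly f -> size f = d.+1 -> injective (a 0) ->
  (forall i, root (toR R f) (a 0 i)) -> p != 0 -> (size p <= d)%N ->
  1 <= `|\prod_(i < d) (toR R p).[a 0 i]|.
Proof.
move=> f_monic f_irr size_f a_inj root_a p_neq0 size_p.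
have [z prodE] := prod_horner_roots_int p f_monic size_f a_inj root_a.
suff : \prod_(i < d) (toR R p).[a 0 i] != 0.
  by rewrite prodE intr_eq0 -intr_norm -[1]/(1%:~R) ler_int; lia.
apply/prodf_neq0 => i _.
have cop : coprimep (toR rat f) (toR rat p).
  rewrite irreducible_poly_coprime; last exact/irreducible_rat_int.
  apply/negP => /dvdp_leq; rewrite -size_poly_gt0 !size_rat_int_poly.
  by rewrite size_poly_gt0 size_f => /(_ p_neq0); rewrite leqNgt ltnS size_p.
have ratrK (q : {poly int}) : map_poly (ratr : rat -> R) (toR rat q) = toR R q.
  by rewrite -map_poly_comp; apply: eq_map_poly => x /=; rewrite ratr_int.
by have := root_a i; apply: coprimep_root; rewrite -!ratrK coprimep_map.
Qed.

Definition spread_poly (d : nat) : {poly int} :=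
  \prod_(i < d) ('X - (8 * i)%:Z%:P).

Definition eisenstein_poly (d : nat) : {poly int} := spread_poly d + 2%:P.

Lemma size_spread_poly d : size (spread_poly d) = d.+1.
Proof. by rewrite /spread_poly -big_enum size_prod_XsubC size_enum_ord. Qed.

(** All the nodes are multiples of 8, so the product is [X ^ d] modulo 8. *)
Lemma spread_polyE d : exists g : {poly int}, spread_poly d = 'X^d + g *+ 8.
Proof.
rewrite /spread_poly; elim: d => [|d [g IH]].
  by exists 0; rewrite big_ord0 mul0rn addr0.
exists (g * 'X - ('X^d + g *+ 8) * d%:Z%:P).
rewrite big_ord_recr /= IH.
by rewrite PoszM polyCM -[8%:Z%:P]/(8%:R%:P) polyC_natr exprS; ring.
Qed.

Lemma size_eisenstein_poly d : (0 < d)%N -> size (eisenstein_poly d) = d.+1.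
Proof.
by move=> d_gt0; rewrite size_polyDl size_spread_poly // size_polyC ltnS.
Qed.

Lemma eisenstein_poly_monic d : (0 < d)%N -> eisenstein_poly d \is monic.
Proof.
move=> d_gt0; rewrite monicE lead_coefDl; last first.
  by rewrite size_spread_poly size_polyC ltnS.
by rewrite -monicE monic_prod_XsubC.
Qed.

Lemma eisenstein_poly_irreducible d : (0 < d)%N ->
  irreducible_poly (eisenstein_poly d).
Proof.
move=> d_gt0; apply: (@eisenstein_crit 2) => //.
- by rewrite size_eisenstein_poly // eqSS -lt0n.
- by rewrite (monicP (eisenstein_poly_monic d_gt0)).
- rewrite -horner_coef0 hornerD hornerC horner_prod.
  by case: d d_gt0 => // d _; rewrite big_ord_recl !hornerE.
- move=> i; rewrite size_eisenstein_poly //= => ltid.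
  have [g gE] := spread_polyE d.
  rewrite /eisenstein_poly gE !coefD coefXn ltn_eqF // add0r coefC.
  by case: eqP => _; lia.
Qed.

(** At the two points [8 i - 2] and [8 i + 2] the values of [spread_poly d]
    have opposite signs, since only the factor of index [i] changes sign between
    them, and absolute value at least 2.  Hence their product stays
    nonpositive after adding 2 to both, and the intermediate value theorem applies. *)
Lemma eisenstein_poly_root (R : rcfType) (d : nat) (i : 'I_d) :
  {x : R | (8 * i)%:R - 2 <= x <= (8 * i)%:R + 2
     & root (toR R (eisenstein_poly d)) x}.
Proof.
pose u (z : int) : int := (spread_poly d).[z].
have uE z : u z = \prod_(j < d) (z - (8 * j)%:Z).
  by rewrite /u horner_prod; apply: eq_bigr => j _; rewrite !hornerE.
pose l := (8 * i)%:Z - 2; pose h := (8 * i)%:Z + 2.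
have norm_u z : z = l \/ z = h -> 2 <= `|u z|.
  move=> zE; rewrite uE normr_prod (bigD1 i) //=.
  rewrite -[2]mulr1 ler_pM //; first by case: zE => ->; rewrite /l /h; lia.
  apply: (big_ind (fun x => 1 <= x)) => //.
    by move=> x y x1 y1; rewrite -[1]mulr1 ler_pM.
  by move=> j _; case: zE => ->; rewrite /l /h; lia.
have u_lt0 : u l * u h < 0.
  rewrite !uE -big_split /= (bigD1 i) //= pmulr_llt0; first by rewrite /l /h; lia.
  apply: prodr_gt0 => j /eqP/val_eqP/= ji.
  (* For j different from i, this is at least 8 ^ 2 - 4. *)
  rewrite (_ : _ * _ = ((8 * i)%:Z - (8 * j)%:Z) ^+ 2 - 4); last first.
    by rewrite /l /h; ring.
  by nia.
have sign : (u l + 2) * (u h + 2) <= 0.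
  by have := norm_u l (or_introl erefl); have := norm_u h (or_intror erefl); nia.
have [||x xlh rx] := @polyrcf.poly_ivt R (toR R (eisenstein_poly d)) l%:~R h%:~R.
- by rewrite ler_int /l /h; lia.
- by rewrite !horner_map -rmorphM lerz0 !hornerD !hornerC.
exists x => //; move: xlh.
by rewrite in_itv /= /l /h intrB intrD.
Qed.

(** The intervals from [8 i - 2] to [8 i + 2] are pairwise disjoint. *)
Lemma eisenstein_poly_roots (R : rcfType) (d : nat) :
  exists2 a : 'rV[R]_d, injective (a 0)
    & forall i, root (toR R (eisenstein_poly d)) (a 0 i).
Proof.
exists (\row_i sval (sig_of_sig2 (eisenstein_poly_root R i))) => [i j|i];
  rewrite !mxE.
  case: (eisenstein_poly_root R i) (eisenstein_poly_root R j)
    => [x xb _] [y yb _] /= xy.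
  move: xb yb; rewrite -xy => /andP[ix xi] /andP[jx xj].
  apply/val_inj => /=.
  have ij : ((8 * i)%:R : R) <= (8 * j + 4)%:R by rewrite natrD; lra.
  have ji : ((8 * j)%:R : R) <= (8 * i + 4)%:R by rewrite natrD; lra.
  by move: ij ji; rewrite !ler_nat; lia.
by case: (eisenstein_poly_root R i).
Qed.

Lemma horner_rVpoly_int (R : numFieldType) (d : nat) (v : 'rV[int]_d) (x : R) :
  (toR R (rVpoly v)).[x] = \sum_(k < d) (v 0 k)%:~R * x ^+ k.
Proof.
rewrite (@horner_coef_wide _ d); last first.
  by rewrite (leq_trans (size_poly _ _)) ?size_poly.
by apply: eq_bigr => k _; rewrite coef_map coef_rVpoly_ord.
Qed.

Lemma rVpoly_eq0 (R : nzRingType) (d : nat) (v : 'rV[R]_d) :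
  (rVpoly v == 0) = (v == 0).
Proof. by rewrite -(inj_eq (can_inj (@rVpolyK R d))) linear0. Qed.

(** The least [m] with [n <= m ^ d] has [(m - 1) ^ d < n], while
    [m <= 2 (m - 1)] as soon as [m] exceeds 1. *)
Lemma root_ceil (d n : nat) : (0 < d)%N -> (0 < n)%N ->
  exists2 m, (0 < m)%N & (n <= m ^ d <= 2 ^ d * n)%N.
Proof.
move=> d_gt0 n_gt0.
have ex_m : exists m, (n <= m ^ d)%N.
  by exists n; rewrite -[leqLHS]expn1 leq_pexp2l.
case: (ex_minnP ex_m) => -[|[|m]] nm m_min.
- by rewrite exp0n // leqn0 in nm; rewrite (eqP nm) in n_gt0.
- by exists 1%N => //; rewrite nm exp1n muln_gt0 expn_gt0.
exists m.+2 => //; rewrite nm.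
have m_lt : (m.+1 ^ d < n)%N.
  by rewrite ltnNge; apply/negP => /m_min; rewrite ltnn.
rewrite (@leq_trans ((2 * m.+1) ^ d)) ?leq_exp2r //; first by lia.
by rewrite expnMn leq_mul2l ltnW // orbT.
Qed.

(** A bound [B] on the values of [\sum_k X ^ k] at the absolute values of the
    roots controls the size of the embedded polynomials; see the introduction
    for the choice of the points.  Injectivity of [g] comes from the lower bound
    itself: equal points would make a product vanish. *)
Lemma spread_points (R : realType) (d : nat) : (0 < d)%N ->
  exists2 c : R, 0 < c & forall n, (0 < n)%N ->
    exists g : 'I_n -> 'rV[R]_d,
      [/\ injective g, forall i, in_unit_cube (g i)
        & forall i j, i != j ->
            c / n%:R <= `|\prod_(k < d) (g i 0 k - g j 0 k)|].
Proof.
move=> d_gt0.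
have [a a_inj root_a] := eisenstein_poly_roots R d.
(* The leading 1 makes [B] positive without a discussion of the sums. *)
pose B : R := 1 + \sum_(i < d) \sum_(k < d) `|a 0 i| ^+ k.
have sum_ge0 i : 0 <= \sum_(k < d) `|a 0 i| ^+ k.
  by apply: sumr_ge0 => k _; rewrite exprn_ge0.
have B_gt0 : 0 < B by rewrite ltr_wpDr // sumr_ge0.
have leB i : \sum_(k < d) `|a 0 i| ^+ k <= B.
  rewrite /B [X in _ <= _ + X](bigD1 i) //= addrCA lerDl addr_ge0 //.
  by apply: sumr_ge0 => j _.
exists ((4 * B) ^- d) => [|n n_gt0]; first by rewrite invr_gt0 exprn_gt0 ?mulr_gt0.
have [m m_gt0 /andP[nm mn]] := root_ceil d_gt0 n_gt0.
have n0 : 0 < n%:R :> R by rewrite ltr0n.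
have Bm_gt0 : 0 < B * m%:R by rewrite mulr_gt0 ?ltr0n.
have le_card : (n <= #|{ffun 'I_d -> 'I_m}|)%N by rewrite card_ffun !card_ord.
pose w (i : 'I_n) : {ffun 'I_d -> 'I_m} := enum_val (widen_ord le_card i).
have w_inj : injective w.
  by move=> i j /enum_val_inj/(congr1 val)/= ij; apply/val_inj.
pose v i : 'rV[int]_d := \row_k (w i k)%:Z.
pose P i := rVpoly (v i).
pose g i : 'rV[R]_d := \row_k ((1 + (toR R (P i)).[a 0 k] / (B * m%:R)) / 2).
have normP i k : `|(toR R (P i)).[a 0 k]| <= B * m%:R.
  rewrite horner_rVpoly_int (le_trans (ler_norm_sum _ _ _)) //.
  rewrite mulrC (le_trans _ (ler_wpM2l (ler0n _ _) (leB k))) // mulr_sumr.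
  apply: ler_sum => l _; rewrite normrM normrX mxE ler_wpM2r ?exprn_ge0 //.
  by rewrite ger0_norm ?ler0z // -pmulrn ler_nat ltnW.
have lower i j : i != j ->
    (4 * B) ^- d / n%:R <= `|\prod_(k < d) (g i 0 k - g j 0 k)|.
  move=> ij.
  have -> : \prod_(k < d) (g i 0 k - g j 0 k) =
      (2 * (B * m%:R)) ^- d * \prod_(k < d) (toR R (P i - P j)).[a 0 k].
    rewrite -[d in X in X * _]card_ord -exprVn -prodr_const -big_split /=.
    apply: eq_bigr => k _; rewrite !mxE rmorphB hornerD hornerN.
    by field; rewrite pnatr_eq0 -lt0n m_gt0 gt_eqF.
  have PijE : P i - P j = rVpoly (v i - v j) by rewrite linearB.
  have Pij : P i - P j != 0.
    rewrite PijE rVpoly_eq0 subr_eq0; apply: contra_neq ij => vij.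
    apply/w_inj/ffunP => k; apply/val_inj.
    by have := congr1 (fun u : 'rV_d => u 0 k) vij; rewrite !mxE => -[].
  rewrite normrM gtr0_norm; last by rewrite invr_gt0 exprn_gt0 ?mulr_gt0 ?ltr0n.
  have size_Pij : (size (P i - P j)%R <= d)%N by rewrite PijE size_poly.
  rewrite -[leLHS]mulr1 ler_pM //.
  - by rewrite ltW // divr_gt0 // invr_gt0 exprn_gt0 ?mulr_gt0.
  - rewrite -invfM lef_pV2 ?posrE ?mulr_gt0 ?exprn_gt0 ?mulr_gt0 ?ltr0n //.
    rewrite mulrA !exprMn (_ : 4 = 2 * 2) ?exprMn; last by ring.
    rewrite -!mulrA ler_wpM2l ?exprn_ge0 // mulrCA.
    rewrite ler_wpM2l ?exprn_ge0 ?(ltW B_gt0) //.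
    by rewrite -natrX -[2]/(2%:R) -natrX -natrM ler_nat.
  - exact: (prod_horner_roots_ge1 (eisenstein_poly_monic d_gt0)
      (eisenstein_poly_irreducible d_gt0) (size_eisenstein_poly d_gt0)).
exists g; split=> // [i j gij|i k].
  have [//|/lower] := eqVneq i j.
  rewrite gij (bigD1 (Ordinal d_gt0)) //= subrr mul0r normr0 leNgt.
  by rewrite divr_gt0 // invr_gt0 exprn_gt0 ?mulr_gt0.
have := normP i k; rewrite mxE ler_norml => /andP[lo hi].
rewrite divr_ge0 ?ler_pdivrMr //=.
  by rewrite mul1r -[leRHS]/(1 + 1) lerD2l ler_pdivrMr // mul1r.
by rewrite -lerBlDl sub0r ler_pdivlMr // mulN1r.
Qed.

Local Open Scope fset_scope.

Lemma fset_of_injection (T : choiceType) (n : nat) (g : 'I_n -> T) :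
  injective g ->
  exists2 A : {fset T}, #|` A| = n & forall x, x \in A -> exists i, x = g i.
Proof.
move=> g_inj; exists [fset g i | i in 'I_n].
  by rewrite card_imfset //= -cardE card_ord.
by move=> x /imfsetP[i _ ->]; exists i.
Qed.

Theorem mainTheorem1 (R : realType) :
  (forall d : nat, (1 <= d)%N ->
    exists c : R, 0 < c /\
      forall n : nat, (0 < n)%N ->
        exists A : {fset 'rV[R]_d},
          [/\ #|` A| = n,
              forall x : 'rV[R]_d, x \in A -> in_unit_cube x
            & forall x y : 'rV[R]_d, x \in A -> y \in A -> x <> y ->
                c / n%:R <= `|\prod_(i < d) (x ord0 i - y ord0 i)|])
  /\
  (exists c : R, 0 < c /\
    forall n : nat, (0 < n)%N ->
      exists A : {fset R * R * R},
        [/\ #|` A| = n,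
            forall x1 x2 x3 : R, (x1, x2, x3) \in A ->
              [/\ 0 <= x1 <= 1, 0 <= x2 <= 1 & 0 <= x3 <= 1]
          & forall x1 x2 x3 y1 y2 y3 : R,
              (x1, x2, x3) \in A -> (y1, y2, y3) \in A ->
              (x1, x2, x3) <> (y1, y2, y3) ->
              c / n%:R <= `|(x1 - y1) * (x2 - y2) * (x3 - y3)|]).
Proof.
split=> [d d_gt0|].
  have [c c_gt0 spread] := spread_points R d_gt0; exists c; split=> // n n_gt0.
  have [g [g_inj g_cube g_spread]] := spread n n_gt0.
  have [A cardA imA] := fset_of_injection g_inj.
  exists A; split=> // [x /imA[i ->] //|x y /imA[i ->] /imA[j ->] gij].
  by apply: g_spread; apply: contra_notN gij => /eqP ->.
have [c c_gt0 spread] := spread_points R (isT : (0 < 3)%N).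
exists c; split=> // n n_gt0.
have [g [g_inj g_cube g_spread]] := spread n n_gt0.
pose e0 : 'I_3 := @Ordinal 3 0 isT.
pose e1 : 'I_3 := @Ordinal 3 1 isT.
pose e2 : 'I_3 := @Ordinal 3 2 isT.
pose h i := (g i 0 e0, g i 0 e1, g i 0 e2).
have prod3 (F : 'I_3 -> R) : \prod_(k < 3) F k = F e0 * F e1 * F e2.
  rewrite !big_ord_recr big_ord0 /= mul1r.
  by congr (F _ * F _ * F _); apply/val_inj.
have h_inj : injective h.
  move=> i j [g0 g1 g2]; apply/g_inj/rowP => -[[|[|[|//]]] lt3].
  - by rewrite (_ : Ordinal lt3 = e0) //; apply/val_inj.
  - by rewrite (_ : Ordinal lt3 = e1) //; apply/val_inj.
  - by rewrite (_ : Ordinal lt3 = e2) //; apply/val_inj.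
have [A cardA imA] := fset_of_injection h_inj.
exists A; split=> // [x1 x2 x3 /imA[i [-> -> ->]]|]; first by split; apply: g_cube.
move=> x1 x2 x3 y1 y2 y3 /imA[i [-> -> ->]] /imA[j [-> -> ->]] hij.
rewrite -(prod3 (fun k => g i 0 k - g j 0 k)).
by apply: g_spread; apply: contra_notN hij => /eqP ->.
Qed.
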